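(* Let $f:[0,\infty)\to[0,\infty)$. Then $f$ is metric-ultrametric-preserving if and only if $f$ is amenable and $f$ is constant on $(0,\infty)$.
   Context: An ultrametric on $X$ is a metric $d$ on $X$ satisfying $d(x,y)\leq \max\{d(x,z),d(z,y)\}$ for all $x,y,z\in X$. A function $f:[0,\infty)\to[0,\infty)$ is metric-ultrametric-preserving if for all metric spaces $(X,d)$, $f\circ d$ is an ultrametric on $X$. $f$ is amenable if $f^{-1}(\{0\})=\{0\}$. *)

(* Defs.v *)
From HB Require Import structures.
From mathcomp Require Import all_boot all_order all_algebra interval_inference.
From mathcomp Require Import boolp classical_sets reals topology.
Set Implicit Arguments.
Unset Strict Implicit.
Unset Printing Implicit Defensive.
Import Order.TTheory GRing.Theory Num.Theory.
Local Open Scope classical_set_scope.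
Local Open Scope ring_scope.

(* [0, +oo[ is the subtype {nonneg R}, and p%:num is the underlying element
   of R. Being a metric is a predicate on a distance function, not a bundled
   metricType, because it also has to be asserted of the composite f \o d;
   is_metric_mdist relates the two. *)
Definition is_metric (R : realType) (X : Type) (d : X -> X -> {nonneg R}) :
    Prop :=
  [/\ forall x y, (d x y)%:num = 0 <-> x = y,
      forall x y, d x y = d y x &
      forall x y z, (d x y)%:num <= (d x z)%:num + (d z y)%:num].

Definition is_ultrametric (R : realType) (X : Type)
    (d : X -> X -> {nonneg R}) : Prop :=
  is_metric d /\
  forall x y z, (d x y)%:num <= Num.max (d x z)%:num (d z y)%:num.

Definition metric_ultrametric_preserving (R : realType)
    (f : {nonneg R} -> {nonneg R}) : Prop :=
  forall (X : Type) (d : X -> X -> {nonneg R}),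
    is_metric d -> is_ultrametric (fun x y => f (d x y)).

Definition amenable (R : realType) (f : {nonneg R} -> {nonneg R}) : Prop :=
  f @^-1` [set 0%:nng] = [set 0%:nng].

Definition constant_on_pos (R : realType) (f : {nonneg R} -> {nonneg R}) :
    Prop :=
  exists c : {nonneg R}, forall t : {nonneg R}, 0 < t%:num -> f t = c.

Lemma is_metric_mdist (R : realType) (M : metricType R) :
  is_metric (fun x y : M => NngNum (mdist_ge0 x y)).
Proof.
split=> [x y|x y|x y z] /=.
- by split=> [/mdist_positivity//|->]; exact: mdistxx.
- by apply/val_inj; exact: metric_sym.
- exact: metric_triangle.
Qed.

(* Main.v *)
(* For the forward direction, an isosceles triangle with legs [b] and base
   [a <= 2b] is a metric space, so the ultrametric inequality on its image gives
   [f a <= f b]. Doubling [b] repeatedly removes the constraint [a <= 2b], and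
   by symmetry [f a = f b] for all positive [a] and [b]. *)
Require Import Defs.
From mathcomp Require Import all_boot all_order all_algebra interval_inference.
From mathcomp Require Import boolp classical_sets reals.
From mathcomp Require Import lra.
Import Order.TTheory GRing.Theory Num.Theory.
Local Open Scope ring_scope.
Set Implicit Arguments.
Unset Strict Implicit.

(* [None] is the apex, the two points [Some _] are the base. *)
Definition isosceles_dist (R : realType) (a b : {nonneg R})
    (x y : option bool) : {nonneg R} :=
  if x == y then 0%:nng else if x && y then a else b.

(** The hypotheses force [b > 0], so distinct points are separated. Going through the apex costs
    [2 * b >= a]; every other detour between distinct points costs [a + b >= b]. *)
Lemma isosceles_is_metric (R : realType) (a b : {nonneg R}) :
  0 < a%:num -> a%:num <= 2 * b%:num -> is_metric (isosceles_dist a b).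
Proof.
move=> a_gt0 a_le2b; split.
- by case=> [[]|] [[]|]; rewrite /isosceles_dist /=; split=> // h; exfalso; lra.
- by case=> [[]|] [[]|].
- by case=> [[]|] [[]|] [[]|]; rewrite /isosceles_dist /=; lra.
Qed.

Section Preserving.
Variables (R : realType) (f : {nonneg R} -> {nonneg R}).
Hypothesis f_preserving : metric_ultrametric_preserving f.

Lemma preserving_le_double (a b : {nonneg R}) :
  0 < a%:num -> a%:num <= 2 * b%:num -> (f a)%:num <= (f b)%:num.
Proof.
move=> a_gt0 a_le2b.
have [_ ultra] := f_preserving (isosceles_is_metric a_gt0 a_le2b).
by have := ultra (Some true) (Some false) None; rewrite maxxx.
Qed.

Lemma preserving_le_expn (n : nat) (a b : {nonneg R}) :
  0 < a%:num -> 0 < b%:num -> a%:num <= 2 ^+ n * b%:num ->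
  (f a)%:num <= (f b)%:num.
Proof.
elim: n b => [|n IHn] b a_gt0 b_gt0 a_le.
  by apply: preserving_le_double => //; rewrite expr0 in a_le; lra.
have [b2 b2E] : exists b2 : {nonneg R}, b2%:num = 2 * b%:num.
  by exists (2 * b%:num)%:nng.
have b2_gt0 : 0 < b2%:num by lra.
(* The degenerate triangle with base exactly [2 * b] gives [f b2 <= f b]; the induction hypothesis
   then compares [a] with the doubled leg. *)
apply: (@le_trans _ _ (f b2)%:num); last by apply: preserving_le_double; lra.
by apply: IHn; rewrite // b2E mulrA -exprSr.
Qed.

Lemma preserving_le (a b : {nonneg R}) :
  0 < a%:num -> 0 < b%:num -> (f a)%:num <= (f b)%:num.
Proof.
(* The Archimedean bound gives [a / b < n], and [n < 2 ^ n], so [n] doublings of [b] reach [a]. *)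
move=> a_gt0 b_gt0; pose n := Num.bound (a%:num / b%:num).
apply: (@preserving_le_expn n) => //; rewrite -ler_pdivrMr //.
apply: ltW; apply: (@lt_trans _ _ n%:R).
  by apply: archi_boundP; rewrite divr_ge0.
by rewrite -natrX ltr_nat ltn_expl.
Qed.

Lemma preserving_constant_on_pos : constant_on_pos f.
Proof.
exists (f 1%:nng) => t t_gt0; apply/val_inj/le_anti.
by rewrite !preserving_le //= ltr01.
Qed.

Lemma preserving_amenable : amenable f.
Proof.
(* In the equilateral triangle of side [t], two distinct vertices give the first part and a single
   vertex the second. *)
have eq0 (t : {nonneg R}) : 0 < t%:num -> f t <> 0%:nng /\ f 0%:nng = 0%:nng.
  move=> t_gt0; have t_le2t : t%:num <= 2 * t%:num by lra.
  have [[f0 _ _] _] := f_preserving (isosceles_is_metric t_gt0 t_le2t).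
  split=> [ft0|]; last by apply/val_inj; exact: (f0 None None).2.
  by have /(f0 (Some true) (Some false)).1 : (f t)%:num = 0 by rewrite ft0.
apply/seteqP; split=> t /=; last first.
  by move=> ->; have [] := eq0 1%:nng ltr01.
move=> ft0; apply/val_inj/eqP => /=; rewrite eq_le [0 <= _]ge0 andbT leNgt.
by apply/negP => /eq0[].
Qed.

End Preserving.

(** The composite of [f] with any metric is a discrete metric scaled by [c]: zero on the diagonal
    and [c] off it. *)
Lemma amenable_constant_preserving (R : realType)
    (f : {nonneg R} -> {nonneg R}) :
  amenable f -> constant_on_pos f -> metric_ultrametric_preserving f.
Proof.
move=> amen [c fc] X d [d0 dC _].
have feq0 t : f t = 0%:nng <-> t = 0%:nng.
  by have /seteqP[sub sup] := amen; split=> [/sub|/sup].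
have fd0 x y : (f (d x y))%:num = 0 <-> x = y.
  split=> [fxy0|xy]; last by rewrite (feq0 _).2 //; apply/val_inj/d0.
  by apply/d0; rewrite (feq0 (d x y)).1 //; apply/val_inj.
have fd_le x y : (f (d x y))%:num <= c%:num.
  have [d_gt0|d_le0] := ltP 0 (d x y)%:num; first by rewrite fc.
  rewrite (feq0 (d x y)).2; first exact: ge0.
  by apply/val_inj/le_anti; rewrite d_le0 /= ge0.
have fd_neq x y : x <> y -> f (d x y) = c.
  by move=> xy; apply: fc; rewrite lt0r ge0 andbT; apply/eqP => /d0.
have ultra x y z :
    (f (d x y))%:num <= Num.max (f (d x z))%:num (f (d z y))%:num.
  (* If [x = z], the second term of the maximum is the left-hand side; otherwise the first term is
     [c], the upper bound from [fd_le]. *)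
  have [->|xz] := pselect (x = z); first by rewrite le_max lexx orbT.
  by rewrite le_max (fd_neq x z) ?fd_le.
split=> //; split=> // [x y|x y z]; first by rewrite dC.
by apply: le_trans (ultra x y z) _; rewrite ge_max lerDl lerDr !ge0.
Qed.

Theorem theorem15 (R : realType) (f : {nonneg R} -> {nonneg R}) :
  metric_ultrametric_preserving f <-> amenable f /\ constant_on_pos f.
Proof.
split=> [f_pres|[]]; last exact: amenable_constant_preserving.
by split; [exact: preserving_amenable | exact: preserving_constant_on_pos].
Qed.
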